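(* Let $\Gamma$ be a discrete Euclidean subring of $\mathbb{C}$ containing $1$ and spanning $\mathbb{C}$, and let $K$ be the quotient field of $\Gamma$. Let $\zeta\in K$ and $r>0$ be such that $r^2\in\mathbb{Q}$. Then the following statements are equivalent: (i) There exists $z\in C(\zeta,r)$ which is not badly approximable with respect to $\Gamma$. (ii) If $r^2=\frac mn$ with $m,n\in\mathbb{N}$ coprime to each other, then $m$ and $n$ are norms of some elements of $\Gamma$.
   Context: The rings $\Gamma$ in question are exactly $\mathbb{Z}[i]$, $\mathbb{Z}[\sqrt{2}\,i]$, $\mathbb{Z}[\frac12(1+\sqrt3\,i)]$, $\mathbb{Z}[\frac12(1+\sqrt7\,i)]$, $\mathbb{Z}[\frac12(1+\sqrt{11}\,i)]$. The norm of $\gamma\in\Gamma$ is $\gamma\bar\gamma=|\gamma|^2$. For $\zeta\in\mathbb{C}$ and $r>0$, $C(\zeta,r)=\{z\in\mathbb{C}\mid |z-\zeta|^2=r^2\}$. A complex number $z$ is badly approximable with respect to $\Gamma$ if there exists $\delta>0$ such that $\left|z-\frac pq\right|\ge\delta/|q|^2$ for all $p,q\in\Gamma$ with $q\ne0$. *)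

(* Defs.v *)
From HB Require Import structures.
From mathcomp Require Import all_boot all_order all_algebra.
From mathcomp Require Import complex.
From mathcomp Require Import classical_sets reals topology normedtype.
Set Implicit Arguments.
Unset Strict Implicit.
Unset Printing Implicit Defensive.
Export numFieldNormedType.Exports.
Import Order.TTheory GRing.Theory Num.Theory.
Local Open Scope classical_set_scope.
Local Open Scope ring_scope.
Local Open Scope complex_scope.

(* The field of complex numbers is [R[i]] for [R : realType]; its order is the
   partial one ([x <= y] iff [y - x] is a nonnegative real) and its norm [`|z|]
   takes values in [R[i]], hence the embeddings [%:C] below. *)

(* The cast to [numFieldType] selects the topology induced by the norm. *)
Definition discrete_subset (R : realType) (G : {pred R[i]}) : Prop :=
  [set` G] `<=` isolated ([set` G] : set (R[i] : numFieldType)).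

Definition spans_complex (R : realType) (G : {pred R[i]}) : Prop :=
  forall z : R[i], exists n (a : 'I_n -> R) (g : 'I_n -> R[i]),
    (forall i, g i \in G) /\ z = \sum_(i < n) (a i)%:C * g i.

(* Euclidean domain in the usual sense: the Euclidean function [phi] is
   arbitrary, and only its values on [G] matter. *)
Definition euclidean_subring (R : realType) (G : {pred R[i]}) : Prop :=
  exists phi : R[i] -> nat,
    forall a b, a \in G -> b \in G -> b != 0 ->
    exists q r, [/\ q \in G, r \in G, a = q * b + r &
                    r = 0 \/ (phi r < phi b)%N].

Definition quotient_field (R : realType) (G : {pred R[i]}) : set R[i] :=
  [set z | exists p q, [/\ p \in G, q \in G, q != 0 & z = p / q]].

Definition circle (R : realType) (zeta : R[i]) (r : R) : set R[i] :=
  [set z | `|z - zeta| ^+ 2 = (r ^+ 2)%:C].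

Definition badly_approximable (R : realType) (G : {pred R[i]}) (z : R[i]) :
    Prop :=
  exists2 delta : R, 0 < delta &
    forall p q, p \in G -> q \in G -> q != 0 ->
      delta%:C / `|q| ^+ 2 <= `|z - p / q|.

Definition is_norm_from (R : realType) (G : {pred R[i]}) (k : nat) : Prop :=
  exists2 g, g \in G & g * g^* = k%:R.

(* Main.v *)
Require Import Defs.
From HB Require Import structures.
From mathcomp Require Import all_boot all_order all_algebra.
From mathcomp Require Import complex.
From mathcomp Require Import classical_sets reals topology normedtype.
From mathcomp Require Import boolp sequences ring lra.
Set Implicit Arguments.
Unset Strict Implicit.
Unset Printing Implicit Defensive.
Import Order.TTheory GRing.Theory Num.Theory.
Local Open Scope ring_scope.
Local Open Scope complex_scope.

(* If [p / q] approximates a point of the circle well and [zeta = c / d], then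
   the integer [n |pd - cq|^2 - m |qd|^2] has absolute value less than 1, so
   [p / q] lies on the circle and [m / n], hence [m n], is a norm from the
   quotient field. Since [Gamma] is a principal ideal domain stable under
   conjugation, [m n] is then a norm from [Gamma], and so are its coprime factors
   [m] and [n]. Conversely, if [m = |a|^2] and [n = |b|^2], then [zeta + a / b] is
   a point of the circle in the quotient field, and such points are not badly
   approximable.

   Discreteness enters through powers: a nonzero element of norm less than 1 would
   have powers accumulating at 0. Hence the real elements of [Gamma] are the
   integers, and [Gamma = Z + Z w] for [w] of least positive imaginary part. *)

(** * Imaginary parts and norms of complex numbers *)

Lemma ImB (R : realType) (x y : R[i]) :
  complex.Im (x - y) = complex.Im x - complex.Im y.
Proof. by case: x y => [? ?] [? ?]. Qed.

Lemma Im_intM (R : realType) (k : int) (x : R[i]) :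
  complex.Im (k%:~R * x) = k%:~R * complex.Im x.
Proof.
by rewrite -(rmorph_int (real_complex R)); case: x => ? ? /=; rewrite mul0r addr0.
Qed.

Lemma norm_complexE (R : realType) (x : R[i]) : `|x| = (complex.Re `|x|)%:C.
Proof. by rewrite RRe_real ?normr_real. Qed.

(** * Structure of a discrete subring: integral basis, conjugation, integral norms *)

Lemma discrete_norm_ge1 (R : realType) (G : subringClosed R[i]) :
  discrete_subset G -> {in G, forall x, x != 0 -> 1 <= `|x|}.
Proof.
move=> Gdisc x xG x0; have [_ [V]] := Gdisc 0 (rpred0 G).
move=> /nbhs_ballP[e /= e0 eV] VG.
rewrite real_leNgt ?normr_real ?real1 //; apply/negP; rewrite norm_complexE.
rewrite -(rmorph1 (real_complex R)) ltcR => x1.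
(* The radius [e] lives in [R[i]]; being positive, it is real. *)
have e_real : (complex.Re e)%:C = e by rewrite RRe_real // gtr0_real.
have eR0 : 0 < complex.Re e by rewrite -ltcR e_real.
have x1' : `|complex.Re `|x| | < 1.
  by rewrite ger0_norm // -lecR -norm_complexE normr_ge0.
have /cvgr0_norm_lt/(_ _ eR0)[N _ /(_ N (leqnn N)) /= xN] := cvg_expr x1'.
have : (V `&` [set` G])%classic (x ^+ N).
  split; last exact: rpredX.
  apply: eV; rewrite -ball_normE /= sub0r normrN normrX norm_complexE.
  rewrite -rmorphXn /= -e_real ltcR.
  exact: le_lt_trans (ler_norm _) xN.
by rewrite VG /= => /eqP; rewrite expf_eq0 (negbTE x0) andbF.
Qed.

(** The fractional part of a real element lies in [G] and has norm less than 1, so it vanishes. *)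
Lemma discrete_real_int (R : realType) (G : subringClosed R[i]) :
  discrete_subset G ->
  {in G, forall x, complex.Im x = 0 -> exists k : int, x = k%:~R}.
Proof.
move=> Gdisc x xG x_real; exists (Num.floor (complex.Re x)).
apply/eqP; rewrite -subr_eq0; apply/negPn/negP => y0.
have yG : x - (Num.floor (complex.Re x))%:~R \in G by rewrite rpredB // rpred_int.
have := discrete_norm_ge1 Gdisc yG y0; apply/negP.
have /andP[lo] := floor_itv (complex.Re x); rewrite intrD => hi.
have -> : x - (Num.floor (complex.Re x))%:~R
  = (complex.Re x - (Num.floor (complex.Re x))%:~R)%:C.
  by rewrite rmorphB /= rmorph_int [in LHS](complexE x) x_real rmorph0 mulr0 addr0.
rewrite -real_ltNge ?normr_real ?real1 // ger0_norm; last by rewrite ler0c subr_ge0.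
by rewrite -(rmorph1 (real_complex R)) ltcR ltrBlDl.
Qed.

Lemma spans_nonreal (R : realType) (G : subringClosed R[i]) :
  spans_complex G -> exists2 x, x \in G & 0 < complex.Im x.
Proof.
move=> /(_ 'i)[n [a [g [gG i_sum]]]].
have [/forallP g_real|/forallPn[j gj]] := boolP [forall j, complex.Im (g j) == 0].
  have := f_equal (@complex.Im R) i_sum.
  rewrite (raddf_sum (@complex.Im R : Rcomplex R -> R)) big1 /= => [/eqP|j _].
    by rewrite oner_eq0.
  have /eqP := g_real j.
  by case: (g j) => u v /= ->; rewrite mulr0 mul0r addr0.
case: (ltgtP (complex.Im (g j)) 0) gj => // gj _; last by exists (g j).
by exists (- g j); rewrite ?rpredN //; case: (g j) gj => u v /=; rewrite oppr_gt0.
Qed.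

(* A smaller imaginary part would give, after an integer translation, an
   element of norm less than 1. *)
Lemma discrete_Im_ge_half (R : realType) (G : subringClosed R[i]) :
  discrete_subset G ->
  {in G, forall x, 0 < complex.Im x -> 1 / 2 <= complex.Im x}.
Proof.
move=> Gdisc x xG x0; rewrite leNgt; apply/negP => x_lt.
(* Rounding to a nearest integer leaves a real part of absolute value at most 1/2, so [x - k] has
   squared norm below 1/2. *)
set k := Num.floor (complex.Re x + 1 / 2).
have yG : x - k%:~R \in G by rewrite rpredB // rpred_int.
have /andP[lo hi] := floor_itv (complex.Re x + 1 / 2).
rewrite -/k intrD in lo hi.
have yE : x - k%:~R = (complex.Re x - k%:~R) +i* complex.Im x.
  by rewrite -(rmorph_int (real_complex R)) [x in LHS]complexE; simpc.
have y0 : x - k%:~R != 0.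
  by rewrite yE eq_complex negb_and /= (gt_eqF x0) orbT.
have := discrete_norm_ge1 Gdisc yG y0.
rewrite -(@ler_pXn2r _ 2) ?nnegrE ?normr_ge0 ?ler01 // expr1n -add_Re2_Im2 yE /=.
rewrite -(rmorph1 (real_complex R)) lecR => le1.
nra.
Qed.

(** Distinct imaginary parts differ by at least 1/2, so descent stops: induction on [n] with
    [complex.Im x < n / 2]. *)
Lemma discrete_min_Im (R : realType) (G : subringClosed R[i]) :
  discrete_subset G -> spans_complex G ->
  exists w, [/\ w \in G, 0 < complex.Im w &
    {in G, forall x, 0 < complex.Im x -> complex.Im w <= complex.Im x}].
Proof.
move=> Gdisc /spans_nonreal[x xG x0].
have [n] : exists n : nat, complex.Im x < n%:R / 2.
  exists (Num.bound (2 * complex.Im x)).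
  have := @archi_boundP _ (2 * complex.Im x); lra.
elim: n x xG x0 => [|n IHn] x xG x0 x_lt; first by exfalso; lra.
have [[y [yG y0 yx]]|no_smaller] :=
  pselect (exists y, [/\ y \in G, 0 < complex.Im y & complex.Im y < complex.Im x]).
  apply: (IHn y yG y0).
  have xy0 : 0 < complex.Im (x - y) by rewrite ImB subr_gt0.
  have := discrete_Im_ge_half Gdisc (rpredB xG yG) xy0; rewrite ImB.
  move: x_lt; rewrite -natr1; lra.
exists x; split=> // y yG y0; rewrite leNgt; apply/negP => yx.
by apply: no_smaller; exists y.
Qed.

(** Division of imaginary parts by that of [w] leaves a remainder in [[0, Im w)], which is 0 by
    minimality; what is left is real, hence an integer. *)
Lemma discrete_basis (R : realType) (G : subringClosed R[i]) :
  discrete_subset G -> spans_complex G ->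
  exists2 w, w \in G & 0 < complex.Im w /\
    {in G, forall x, exists k l : int, x = k%:~R + l%:~R * w}.
Proof.
move=> Gdisc Gspan; have [w [wG w0 w_min]] := discrete_min_Im Gdisc Gspan.
exists w => //; split=> // x xG.
set l := Num.floor (complex.Im x / complex.Im w).
have yG : x - l%:~R * w \in G by rewrite rpredB // rpredM // rpred_int.
have yE : complex.Im (x - l%:~R * w) = complex.Im x - l%:~R * complex.Im w.
  by rewrite ImB Im_intM.
have /andP[] := floor_itv (complex.Im x / complex.Im w).
rewrite -/l ler_pdivlMr // ltr_pdivrMr // intrD => lo hi.
have y_real : complex.Im (x - l%:~R * w) = 0.
  have y_ge0 : 0 <= complex.Im (x - l%:~R * w) by rewrite yE subr_ge0.
  apply/eqP; rewrite eq_le y_ge0 andbT leNgt; apply/negP => /(w_min _ yG).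
  rewrite yE; lra.
have [k xk] := discrete_real_int Gdisc yG y_real.
by exists k, l; rewrite -xk subrK.
Qed.

(** The basis gives [w^2 = a + b w] with integers [a], [b]. As [w] is not real, [w^*] is the other
    root, so [w + w^* = b]. *)
Lemma discrete_conj (R : realType) (G : subringClosed R[i]) :
  discrete_subset G -> spans_complex G -> {in G, forall x, x^* \in G}.
Proof.
move=> Gdisc Gspan; have [w wG [w0 basis]] := discrete_basis Gdisc Gspan.
have wJG : w^* \in G.
  have [a [b w2]] := basis _ (rpredM wG wG).
  have w2J : w^* * w^* = a%:~R + b%:~R * w^*.
    by rewrite -rmorphM w2 rmorphD rmorphM !rmorph_int.
  suff -> : w^* = b%:~R - w by rewrite rpredB // rpred_int.
  have wwJ : w - w^* != 0.
    apply/eqP => /(f_equal (@complex.Im R)); rewrite ImB.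
    by case: w w0 {wG basis w2 w2J} => u v /=; lra.
  apply: (mulIf wwJ).
  have -> : w^* * (w - w^*) = w^* * w - (a%:~R + b%:~R * w^*) by rewrite -w2J mulrBr.
  have -> : (b%:~R - w) * (w - w^*) = b%:~R * w - b%:~R * w^* + w * w^* - w * w by ring.
  by rewrite w2; ring.
move=> x /basis[k [l ->]].
by rewrite rmorphD rmorphM !rmorph_int rpredD ?rpredM ?rpred_int.
Qed.

Lemma discrete_norm_nat (R : realType) (G : subringClosed R[i]) :
  discrete_subset G -> spans_complex G ->
  {in G, forall x, exists k : nat, x * x^* = k%:R}.
Proof.
move=> Gdisc Gspan x xG.
have xJG := discrete_conj Gdisc Gspan xG.
have [|k xk] := discrete_real_int Gdisc (rpredM xG xJG).
  by rewrite ger0_Im // mulcJ_ge0.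
have k0 : 0 <= k by rewrite -(ler0z R[i]) -xk mulcJ_ge0.
by exists `|k|%N; rewrite xk -[in LHS](gez0_abs k0).
Qed.

(** * Divisibility and norms in the Euclidean ring *)

(** Euclid's algorithm, by induction on [phi b]; the cofactors [a'] and [b'] record that [g] is a
    common divisor. *)
Lemma euclidean_bezout (R : realType) (G : subringClosed R[i]) :
  euclidean_subring G ->
  {in G &, forall a b, exists g a' b' u v,
    [/\ g \in G, a' \in G, b' \in G, u \in G & v \in G] /\
    [/\ g = u * a + v * b, a = a' * g & b = b' * g]}.
Proof.
move=> [phi phi_div] a b aG bG.
(* Needed also for a zero remainder, where [phi] need not decrease. *)
have bezout0 a1 : a1 \in G -> exists g a' b' u v,
    [/\ g \in G, a' \in G, b' \in G, u \in G & v \in G] /\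
    [/\ g = u * a1 + v * 0, a1 = a' * g & 0 = b' * g].
  move=> a1G; exists a1, 1, 0, 1, 0.
  by rewrite rpred0 rpred1 a1G !mul1r !mul0r addr0.
have [n] := ubnP (phi b); elim: n a b aG bG => // n IHn a b aG bG phi_b.
have [->|b0] := eqVneq b 0; first exact: bezout0.
have [q [s [qG sG a_eq s_lt]]] := phi_div a b aG bG b0.
have [g [b' [s' [u [v [[gG b'G s'G uG vG] [g_eq b_eq s_eq]]]]]]] :
    exists g b' s' u v,
    [/\ g \in G, b' \in G, s' \in G, u \in G & v \in G] /\
    [/\ g = u * b + v * s, b = b' * g & s = s' * g].
  case: s_lt => [->|s_lt]; first exact: bezout0.
  by apply: IHn => //; apply: leq_trans s_lt _.
exists g, (q * b' + s'), b', v, (u - v * q).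
split; first by split; rewrite ?rpredD ?rpredN ?rpredM.
split=> //; first by rewrite g_eq a_eq; ring.
by rewrite a_eq mulrDl -mulrA -b_eq -s_eq.
Qed.

(* Write the element as [x / y] in lowest terms: [y] divides [x * x^*] and is
   coprime to [x], so it divides [x^*]. *)
Lemma norm_from_fraction (R : realType) (G : subringClosed R[i]) (k : nat)
    (x y : R[i]) :
  euclidean_subring G -> {in G, forall t, t^* \in G} ->
  x \in G -> y \in G -> y != 0 -> x * x^* = k%:R * (y * y^*) ->
  is_norm_from G k.
Proof.
move=> Geuc Gconj xG yG y0 xy.
have [g [x' [y' [u [v [[gG x'G y'G uG vG] [g_eq x_eq y_eq]]]]]]] :=
  euclidean_bezout Geuc xG yG.
have g0 : g != 0 by apply: contraNneq y0 => g0; rewrite y_eq g0 mulr0.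
have y'0 : y' != 0 by apply: contraNneq y0 => y'0; rewrite y_eq y'0 mul0r.
have ux : 1 = u * x' + v * y'.
  by apply: (mulIf g0); rewrite mul1r mulrDl -!mulrA -x_eq -y_eq.
have xy' : x' * x'^* = k%:R * (y' * y'^*).
  have gg0 : g * g^* != 0 by rewrite mulf_neq0 // conjc_eq0.
  apply: (mulIf gg0); move: xy; rewrite x_eq y_eq !rmorphM /= => xy.
  by rewrite mulrACA xy; ring.
(* Obtained by multiplying [1 = u x' + v y'] by [x'^*] and substituting [x' x'^* = k y' y'^*]. *)
pose t := u * (k%:R * y'^*) + v * x'^*.
have xt : x'^* = y' * t.
  by rewrite -[LHS]mul1r ux mulrDl -mulrA xy' /t; ring.
exists t; first by rewrite rpredD ?rpredM ?rpred_nat ?Gconj.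
have yy0 : y' * y'^* != 0 by rewrite mulf_neq0 // conjc_eq0.
have xtJ : x' = y'^* * t^* by rewrite -[LHS]conjcK xt rmorphM.
by apply: (mulfI yy0); rewrite mulrACA -xt -xtJ mulrC xy' mulrC.
Qed.

(* [g = gcd(a, x)] works, where [x * x^* = a * b]: the ideal generated by
   [g * g^*] is generated by [a^2], [a * x], [a * x^*] and [a * b], hence by
   [a]. *)
Lemma norm_from_coprime_factor (R : realType) (G : subringClosed R[i])
    (a b : nat) :
  euclidean_subring G -> {in G, forall t, t^* \in G} ->
  {in G, forall t, t != 0 -> 1 <= `|t|} ->
  (0 < a)%N -> coprime a b -> is_norm_from G (a * b) -> is_norm_from G a.
Proof.
move=> Geuc Gconj Gnorm1 a0 cop [x xG x_norm].
have aG : a%:R \in G by rewrite rpred_nat.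
have [g [a' [x' [u [v [[gG a'G x'G uG vG] [g_eq a_eq x_eq]]]]]]] :=
  euclidean_bezout Geuc aG xG.
have [s [t st]] : exists s t : int, s * a%:Z + t * b%:Z = 1.
  have [s [t st]] := Bezoutz a b; exists s, t.
  by rewrite st /gcdz !absz_nat (eqP cop).
have stC : s%:~R * a%:R + t%:~R * b%:R = 1 :> R[i].
  by have := f_equal (fun k : int => k%:~R : R[i]) st; rewrite rmorphD !rmorphM.
have aC0 : a%:R != 0 :> R[i] by rewrite pnatr_eq0 -lt0n.
(* [h1] is the quotient of [g g^*] by [a]; [h2] below is the inverse quotient. *)
pose h1 := u * u^* * a%:R + u * x^* * v^* + v * x * u^* + v * v^* * b%:R.
have h1G : h1 \in G by rewrite !rpredD ?rpredM ?rpred_nat ?Gconj.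
have h1E : g * g^* = a%:R * h1.
  rewrite {1 2}g_eq rmorphD !rmorphM rmorph_nat /=.
  have -> : (u * a%:R + v * x) * (u^* * a%:R + v^* * x^*)
    = a%:R * (u * u^* * a%:R + u * x^* * v^* + v * x * u^*)
      + v * v^* * (x * x^*) by ring.
  by rewrite x_norm natrM /h1; ring.
pose h2 := s%:~R * a' * a'^* + t%:~R * x' * x'^*.
have h2G : h2 \in G by rewrite rpredD ?rpredM ?rpred_int ?Gconj.
have h2E : a%:R = g * g^* * h2.
  have aa : a%:R * a%:R = a' * a'^* * (g * g^*).
    have aJ : a%:R = a'^* * g^* by rewrite -rmorphM -a_eq rmorph_nat.
    by rewrite [X in X * _]a_eq aJ mulrACA.
  have xx : a%:R * b%:R = x' * x'^* * (g * g^*).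
    by rewrite -natrM -x_norm x_eq rmorphM /= mulrACA.
  apply: (@eq_trans _ _ (s%:~R * (a%:R * a%:R) + t%:~R * (a%:R * b%:R))).
    by rewrite -[LHS]mulr1 -[X in _ * X = _]stC; ring.
  by rewrite aa xx /h2; ring.
have gg0 : g * g^* != 0.
  by apply: contraNneq aC0 => gg0; rewrite h2E gg0 mul0r.
have h10 : h1 != 0 by apply: contraNneq gg0 => h10; rewrite h1E h10 mulr0.
have h20 : h2 != 0 by apply: contraNneq aC0 => h20; rewrite h2E h20 mulr0.
(* Since [h1] and [h2] have norm at least 1, each of [a] and [g g^*] bounds the other. *)
exists g => //; apply: le_anti; apply/andP; split.
  rewrite -[leRHS]ger0_norm ?ler0n // h2E normrM ger0_norm ?mulcJ_ge0 //.
  by rewrite ler_peMr ?mulcJ_ge0 ?Gnorm1.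
rewrite -[leRHS]ger0_norm ?mulcJ_ge0 // h1E normrM ger0_norm ?ler0n //.
by rewrite ler_peMr ?ler0n ?Gnorm1.
Qed.

(** * Points of the quotient field on the circle *)

Lemma norm_real_complex (R : realType) (x : R) : `|x%:C| = `|x|%:C.
Proof. by rewrite normc_def /= expr0n addr0 sqrtr_sqr. Qed.

Lemma circle_rational_point (R : realType) (G : subringClosed R[i])
    (zeta z : R[i]) (r : R) (m n : nat) :
  discrete_subset G -> spans_complex G ->
  quotient_field G zeta -> 0 < r -> (0 < n)%N -> r ^+ 2 = m%:R / n%:R ->
  circle zeta r z -> ~ badly_approximable G z ->
  exists2 x, quotient_field G x & circle zeta r x.
Proof.
move=> Gdisc Gspan [c [d [cG dG d0 zeta_eq]]] r0 n0 r2 z_circle z_nba.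
have Gnorm_nat x : x \in G -> x != 0 -> exists2 k : nat, (0 < k)%N & `|x| ^+ 2 = k%:R.
  move=> xG x0; have [k xk] := discrete_norm_nat Gdisc Gspan xG.
  exists k; last by rewrite sqr_normc.
  by rewrite lt0n -(pnatr_eq0 R[i]) -xk mulf_neq0 // conjc_eq0.
have [D D0 dD] := Gnorm_nat _ dG d0.
have D0R : 0 < D%:R :> R by rewrite ltr0n.
have n0R : 0 < n%:R :> R by rewrite ltr0n.
(* Chosen so that the integer [n A - m Q D] below is at most [M |z - p/q| |q|^2] in absolute value;
   [delta = 1 / (M + 1)] makes this less than 1. *)
pose M : R := n%:R * D%:R * (2 * r + 1).
have M0 : 0 < M by rewrite !mulr_gt0 // addr_gt0 // mulr_gt0.
have M1 : 0 < M + 1 by rewrite addr_gt0.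
have delta0 : 0 < (M + 1)^-1 by rewrite invr_gt0.
have [p [q [pG qG q0 pq_lt]]] : exists p q, [/\ p \in G, q \in G, q != 0 &
    `|z - p / q| < (M + 1)^-1%:C / `|q| ^+ 2].
  apply: contrapT => nex; apply: z_nba; exists (M + 1)^-1 => // p q pG qG q0.
  rewrite real_leNgt ?normr_real //; last first.
    by rewrite ger0_real // divr_ge0 ?exprn_ge0 ?normr_ge0 // ler0c ltW.
  by apply/negP => lt; apply: nex; exists p, q.
exists (p / q); first by exists p, q.
have [Q Q0 qQ] := Gnorm_nat _ qG q0.
have Q1R : 1 <= Q%:R :> R by rewrite ler1n.
have eE := norm_complexE (z - p / q).
have e0 : 0 <= complex.Re `|z - p / q| by rewrite -ler0c -eE normr_ge0.
have eQ : complex.Re `|z - p / q| * Q%:R < (M + 1)^-1.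
  rewrite -ltcR rmorphM rmorph_nat /= -eE -qQ -ltr_pdivlMr //.
  by rewrite exprn_gt0 // normr_gt0.
set e := complex.Re _ in eE e0 eQ.
have e1 : e <= 1.
  have : (M + 1)^-1 <= 1 by rewrite invf_le1 // lerDr ltW.
  nra.
have wE : `|z - zeta| = r%:C.
  apply/eqP; rewrite -(@eqrXn2 _ 2) ?normr_ge0 ?ler0c ?ltW //.
  by rewrite z_circle rmorphXn.
have [A AE] : exists A : nat, `|p * d - c * q| ^+ 2 = A%:R.
  have [A] := discrete_norm_nat Gdisc Gspan (rpredB (rpredM pG dG) (rpredM cG qG)).
  by rewrite -sqr_normc; exists A.
have pqE : `|p / q - zeta| ^+ 2 = (A%:R / (Q%:R * D%:R))%:C.
  have -> : p / q - zeta = (p * d - c * q) / (q * d).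
    by rewrite zeta_eq; field; rewrite q0 d0.
  by rewrite normf_div normrM expr_div_n exprMn AE qQ dD fmorph_div rmorphM /= !rmorph_nat.
(* Factor the difference of squares: the two distances to [zeta] differ by at most [e] and add up to
   at most [2 r + e], where [e <= 1]. *)
have close : `|A%:R / (Q%:R * D%:R) - r ^+ 2| <= e * (2 * r + 1).
  rewrite -lecR -norm_real_complex rmorphB /= -pqE rmorphXn /= -wE subr_sqr normrM.
  rewrite rmorphM /= -eE ler_pM ?normr_ge0 //.
    have -> : z - p / q = (z - zeta) - (p / q - zeta) by ring.
    by rewrite distrC ler_dist_dist.
  rewrite ger0_norm ?addr_ge0 ?normr_ge0 //.
  have -> : p / q - zeta = (z - zeta) - (z - p / q) by ring.
  apply: le_trans (lerD (ler_normB _ _) (lexx _)) _.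
  by rewrite wE eE -!rmorphD lecR; lra.
rewrite /circle /= pqE; congr (_%:C).
have D0' := lt0r_neq0 D0R; have n0' := lt0r_neq0 n0R.
have Q0' : Q%:R != 0 :> R by rewrite pnatr_eq0 -lt0n.
have intE : A%:R / (Q%:R * D%:R) - r ^+ 2 =
    ((n * A)%:Z - (m * (Q * D))%:Z)%:~R / (n%:R * Q%:R * D%:R).
  by rewrite r2 rmorphB /= -!pmulrn !natrM; field; rewrite D0' n0' Q0'.
move: close; rewrite intE normrM normfV ler_pdivrMr; last first.
  by rewrite normr_gt0 !mulf_neq0.
rewrite (ger0_norm (_ : 0 <= n%:R * Q%:R * D%:R)) ?mulr_ge0 // => close.
have Mdelta : M * (M + 1)^-1 < 1 by rewrite ltr_pdivrMr // mul1r ltrDl.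
have : `|((n * A)%:Z - (m * (Q * D))%:Z)%:~R| < 1 :> R.
  apply: le_lt_trans close _; apply: le_lt_trans Mdelta.
  have -> : e * (2 * r + 1) * (n%:R * Q%:R * D%:R) = M * (e * Q%:R) by rewrite /M; ring.
  by rewrite ler_pM2l // ltW.
rewrite -intr_norm -[1]/(1%:~R) ltr_int -[1]add0r ltzD1 normr_le0 => /eqP int0.
by apply/eqP; rewrite -subr_eq0 intE int0 mul0r.
Qed.

Lemma quotient_field_sub (R : realType) (G : subringClosed R[i]) (x y : R[i]) :
  quotient_field G x -> quotient_field G y -> quotient_field G (x - y).
Proof.
move=> [a [b [aG bG b0 ->]]] [c [d [cG dG d0 ->]]].
exists (a * d - c * b), (b * d); split.
- by rewrite rpredB ?rpredM.
- by rewrite rpredM.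
- by rewrite mulf_neq0.
- by field; rewrite b0 d0.
Qed.

Lemma quotient_field_not_badly_approximable (R : realType)
    (G : subringClosed R[i]) (x : R[i]) :
  quotient_field G x -> ~ badly_approximable G x.
Proof.
move=> [p [q [pG qG q0 ->]]] [delta delta0 /(_ p q pG qG q0)].
by rewrite subrr normr0 lt_geF // divr_gt0 ?exprn_gt0 ?normr_gt0 // ltcR.
Qed.

Theorem corollary3p11 (R : realType) (Gamma : {pred R[i]%C})
    (Gamma_subring : GRing.subring_closed Gamma)
    (Gamma_discrete : discrete_subset Gamma)
    (Gamma_spans : spans_complex Gamma)
    (Gamma_euclidean : euclidean_subring Gamma)
    (zeta : R[i]%C) (zeta_K : quotient_field Gamma zeta)
    (r : R) (r_gt0 : 0 < r) (r2_rat : exists s : rat, r ^+ 2 = ratr s) :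
  (exists z : R[i]%C, circle zeta r z /\ ~ badly_approximable Gamma z)
  <->
  (forall m n : nat, (0 < m)%N -> (0 < n)%N -> coprime m n ->
     r ^+ 2 = m%:R / n%:R -> is_norm_from Gamma m /\ is_norm_from Gamma n).
Proof.
(* Bundling [Gamma] as a [subringClosed] structure gives access to the lemmas above. *)
have [G G_eq] : exists G : subringClosed R[i], G = Gamma :> {pred R[i]}.
  by exists (HB.pack_for (subringClosed R[i]) Gamma
    (GRing.isSubringClosed.Build R[i] Gamma Gamma_subring)).
move: Gamma_discrete Gamma_spans Gamma_euclidean zeta_K.
rewrite -{}G_eq {Gamma Gamma_subring}.
move=> Gdisc Gspan Geuc zeta_K.
have Gconj := discrete_conj Gdisc Gspan.
split=> [[z [z_circle z_nba]] m n m0 n0 cop r2|norms].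
  have [x xK x_circle] :=
    circle_rational_point Gdisc Gspan zeta_K r_gt0 n0 r2 z_circle z_nba.
  have [a [b [aG bG b0 ab]]] := quotient_field_sub xK zeta_K.
  (* From [|a / b|^2 = m / n] follows [|n a|^2 = m n |b|^2]. *)
  have mn : is_norm_from G (m * n).
    have nC0 : n%:R != 0 :> R[i] by rewrite pnatr_eq0 -lt0n.
    have bb0 : b * b^* != 0 by rewrite mulf_neq0 ?conjc_eq0.
    apply: (norm_from_fraction (x := n%:R * a) Geuc Gconj _ bG b0).
      by rewrite rpredM ?rpred_nat.
    move: x_circle; rewrite /circle /= ab r2 normf_div expr_div_n !sqr_normc.
    rewrite fmorph_div !rmorph_nat => /eqP.
    rewrite eqr_div // => /eqP aJ.
    by rewrite rmorphM rmorph_nat mulrACA -[LHS]mulrA [_ * (a * _)]mulrC aJ natrM; ring.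
  have factor := norm_from_coprime_factor Geuc Gconj (discrete_norm_ge1 Gdisc).
  split; first exact: factor mn.
  by apply: (factor n m) => //; [rewrite coprime_sym | rewrite mulnC].
have [s rs] := r2_rat.
have s0 : 0 < s by rewrite -(ltr0q R) -rs exprn_gt0.
(* The reduced form of [s] supplies the coprime pair for which the norm condition is used. *)
have num0 : (0 < `|numq s|)%N by rewrite absz_gt0 gt_eqF // numq_gt0.
have den0 : (0 < `|denq s|)%N by rewrite absz_gt0 denq_eq0.
have r2 : r ^+ 2 = `|numq s|%:R / `|denq s|%:R.
  by rewrite rs /ratr !pmulrn !gez0_abs // ?denq_ge0 // ltW ?numq_gt0.
have [[a aG a_norm] [b bG b_norm]] := norms _ _ num0 den0 (coprime_num_den s) r2.
have b0 : b != 0.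
  by apply: contraTneq den0 => b0; rewrite -leqNgt leqn0 -(pnatr_eq0 R[i]) -b_norm b0 mul0r.
exists (zeta + a / b); split.
  rewrite /circle /= addrAC subrr add0r normf_div expr_div_n !sqr_normc a_norm b_norm.
  by rewrite r2 fmorph_div !rmorph_nat.
apply: quotient_field_not_badly_approximable.
rewrite -[a / b]opprK -mulNr; apply: quotient_field_sub zeta_K _.
by exists (- a), b; rewrite rpredN.
Qed.
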